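(* Suppose $f\in\mathcal{F}$ can be written as $$f(x)=\sum_{j=1}^{N}c_{j}\,x^{\rho_{j}}(\ln x)^{m_{j}}+R(x)$$ for some collection of constants $c_{j}\in\mathbb{C}$, $\rho_{j}\in\mathbb{C}\setminus\{0\}$ and $m_{j}\in\mathbb{Z}_{\geq 0}$, and some remainder function $R(x)$ satisfying $P^{r}[R](x)\to L$ classically as $x\to\infty$ for some non-negative integer $r$. Then $f$ has generalised Cesàro limit $L$, i.e. $\operatorname{Clim}_{x\to\infty}f(x)=L$.
   Context: $\mathcal{F}$ is the space of complex-valued functions $f$ on $[0,\infty)$ such that $\int_{0}^{x}|f(t)(\ln t)^{m}|\,dt<\infty$ for all $x\geq 1$ and all integers $m\geq 0$ (values at the single point $0$ are irrelevant). The continuous Cesàro operator $P:\mathcal{F}\to\mathcal{F}$ is $$P[f](x)=\frac{1}{x}\int_{0}^{x}f(t)\,dt ,$$ and $P^r$ denotes its $r$-fold iterate ($P^0$ the identity). A complex polynomial $q$ is called regular if $q(1)=1$; $q(P)$ is then called a regular polynomial in $P$. A function $f\in\mathcal{F}$ has generalised Cesàro limit $L$, written $\operatorname{Clim}_{x\to\infty}f(x)=L$, if there is a regular polynomial $q(P)$ such that $q(P)[f](x)$ converges classically to $L$ as $x\to\infty$. *)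

(* Defs.v *)
From HB Require Import structures.
From mathcomp Require Import all_boot all_order all_algebra.
From mathcomp Require Import complex.
From mathcomp Require Import all_classical all_reals all_analysis.

Set Implicit Arguments.
Unset Strict Implicit.
Unset Printing Implicit Defensive.

Import Order.TTheory GRing.Theory Num.Theory.
Import numFieldNormedType.Exports.

Local Open Scope classical_set_scope.
Local Open Scope ring_scope.
Local Open Scope complex_scope.

(* Functions on [0, +oo[ are represented by total functions [R -> R[i]]: no
   definition below looks at values at points [x <= 0].

   "Measurable" and "integral" refer to the completed Lebesgue measure, whose
   sigma-algebra consists of all the Lebesgue measurable sets; [lebesgueTypeR R]
   is [R] with that sigma-algebra (the default one on [R] is Borel's). *)

Notation lebesgueTypeR R :=
  (caratheodory_type (mu_ext (wlength (@idfun (Real.sort R))))).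

Notation completed_mu R := (@completed_lebesgue_measure R).

Definition lebesgue_measurable_fun (R : realType) (D : set R) (g : R -> R) :
    Prop :=
  measurable_fun (D : set (lebesgueTypeR R)) (g : lebesgueTypeR R -> R).

(* The library only has integrals of (extended) real functions. *)
Definition cintegral (R : realType) (D : set R) (f : R -> R[i]) : R[i] :=
  (\int[completed_mu R]_(t in D) complex.Re (f t)) +i*
  (\int[completed_mu R]_(t in D) complex.Im (f t)).

Definition spaceF (R : realType) (f : R -> R[i]) : Prop :=
  [/\ lebesgue_measurable_fun `]0, +oo[ (fun t => complex.Re (f t)),
      lebesgue_measurable_fun `]0, +oo[ (fun t => complex.Im (f t)) &
      forall (x : R) (m : nat), 1 <= x ->
        (\int[completed_mu R]_(t in `]0%R, x])
           (Normc.normc (f t * (ln t ^+ m)%:C))%:E < +oo)%E].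

(* Integrals of non-integrable functions have junk values: [cesaroP] is only
   meaningful on [spaceF], which it maps to itself. *)
Definition cesaroP (R : realType) (f : R -> R[i]) : R -> R[i] :=
  fun x => (x^-1)%:C * cintegral `]0, x] f.

Definition poly_cesaro (R : realType) (q : {poly R[i]}) (f : R -> R[i]) :
    R -> R[i] :=
  fun x => \sum_(k < size q) q`_k * iter k (@cesaroP R) f x.

Definition regular_poly (R : realType) (q : {poly R[i]}) : Prop := q.[1] = 1.

(* Classical convergence f(x) --> L as x --> +oo; [R[i]^o] carries the usual
   topology, given by the modulus. *)
Definition classical_lim (R : realType) (f : R -> R[i]) (L : R[i]) : Prop :=
  f x @[x --> +oo%R] --> (L : R[i]^o).

Definition Clim (R : realType) (f : R -> R[i]) (L : R[i]) : Prop :=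
  spaceF f /\
  exists q : {poly R[i]},
    regular_poly q /\ classical_lim (poly_cesaro q f) L.

(* x^rho = exp (rho * ln x), for x > 0 *)
Definition cpowR (R : realType) (x : R) (rho : R[i]) : R[i] :=
  (expR (complex.Re rho * ln x))%:C *
  (cos (complex.Im rho * ln x) +i* sin (complex.Im rho * ln x)).

(* Main.v *)
Require Import Defs.
From HB Require Import structures.
From mathcomp Require Import all_boot all_order all_algebra.
From mathcomp Require Import complex.
From mathcomp Require Import all_classical all_reals all_analysis.
From mathcomp Require Import measurable_realfun ring lra.
Import Order.TTheory GRing.Theory Num.Theory.
Import numFieldNormedType.Exports.
Local Open Scope classical_set_scope.
Local Open Scope ring_scope.
Local Open Scope complex_scope.
Set Implicit Arguments.
Unset Strict Implicit.
Unset Printing Implicit Defensive.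

(** The averaging operator P has x^rho as an eigenfunction, for the eigenvalue
    1 / (1 + rho), as soon as Re rho > -1. With a factor (ln x)^m it is a
    generalised eigenfunction: integrating the derivative of x^(rho + 1) (ln x)^m
    gives u_m = (1 + rho) P u_m + m P u_(m-1) for u_m = x^rho (ln x)^m. Hence the
    polynomial ((1 + rho) X - 1) / rho, whose value at 1 is 1, lowers the power
    of the logarithm, and its power of exponent m + 1 kills u_m
    ([cesaroP_log_pow], [annihilatorX_log_pow]).

    The exponents with Re rho > -1 are therefore removed by the product of their
    annihilators, which is a regular polynomial. The other terms of the expansion
    may fail to be integrable at 0, but they tend to 0 at infinity
    ([classical_lim_log_pow0]), so they are moved to the remainder. When P^r acts
    on the remainder with r > 0, their sum is a difference of functions of the
    space, hence lies in it even if its terms do not, and P^r sends it to a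
    function with limit 0. So the new remainder T still satisfies P^r T -> L, and
    the polynomial product of the annihilators times X^r gives the limit L,
    because P preserves limits ([cvg_cesaroR], [classical_lim_poly_cesaro]).

    All this needs P to be linear along every orbit, thus to map the space to
    itself: this is [log_integrable_cesaroR], an application of Fubini's theorem.
    The analysis is done on real functions, the real and imaginary parts. *)

(** * From Borel to Lebesgue measurable sets *)

Section lebesgue_measurable_sets.
Context {R : realType}.
Implicit Types (D : set R) (g : R -> R).

Lemma borel_lebesgue_measurable D :
  measurable (D : set (measurableTypeR R)) ->
  measurable (D : set (lebesgueTypeR R)).
Proof. exact: sub_caratheodory. Qed.

(** The identity of the line, seen as a measurable map from the larger to the
    smaller sigma-algebra. The completed measure pushed forward along it is the
    Borel one by conversion, which is what transports integrals below. *)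
Definition lebesgue_to_borel (t : lebesgueTypeR R) : measurableTypeR R := t.

Lemma measurable_lebesgue_to_borel : measurable_fun setT lebesgue_to_borel.
Proof.
by move=> _ D mD; rewrite setTI; exact: borel_lebesgue_measurable.
Qed.

Lemma measurable_fun_borel_lebesgue d (Y : measurableType d) D (g : R -> Y) :
  measurable (D : set (measurableTypeR R)) ->
  measurable_fun (D : set (measurableTypeR R)) (g : measurableTypeR R -> Y) ->
  measurable_fun (D : set (lebesgueTypeR R)) (g : lebesgueTypeR R -> Y).
Proof.
by move=> mD mg _ A mA; apply: borel_lebesgue_measurable; exact: mg.
Qed.

Lemma measurable_itv_lebesgue (i : interval R) :
  measurable ([set` i] : set (lebesgueTypeR R)).
Proof. by apply: borel_lebesgue_measurable; exact: measurable_itv. Qed.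

Lemma ge0_integral_completed D (g : R -> \bar R) :
  measurable (D : set (measurableTypeR R)) ->
  measurable_fun (D : set (measurableTypeR R)) g ->
  (forall t, D t -> (0 <= g t)%E) ->
  (\int[completed_mu R]_(t in D) g t = \int[lebesgue_measure]_(t in D) g t)%E.
Proof.
move=> mD mg g0; have g0' : {in D, forall t, (0 <= g t)%E}.
  by move=> t /set_mem; exact: g0.
by have := ge0_integral_pushforward measurable_lebesgue_to_borel
  (completed_mu R) mD mg g0'.
Qed.

Lemma integrable_completed D (g : R -> \bar R) :
  measurable (D : set (measurableTypeR R)) ->
  (@lebesgue_measure R).-integrable D g ->
  (completed_mu R).-integrable (D : set (lebesgueTypeR R)) g.
Proof.
move=> mD /integrableP[mg gfin]; apply/integrableP; split.
  exact: measurable_fun_borel_lebesgue.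
by rewrite ge0_integral_completed//; exact: measurableT_comp.
Qed.

Lemma integral_completed D (g : R -> \bar R) :
  measurable (D : set (measurableTypeR R)) ->
  measurable_fun (D : set (measurableTypeR R)) g ->
  (\int[completed_mu R]_(t in D) g t = \int[lebesgue_measure]_(t in D) g t)%E.
Proof.
move=> mD mg; rewrite integralE [RHS]integralE !ge0_integral_completed//.
- exact: measurable_funeneg.
- exact: measurable_funepos.
Qed.

End lebesgue_measurable_sets.

(** * Integrability against all powers of the logarithm *)

Section log_integrable.
Context {R : realType}.
Implicit Types (g h : R -> R) (x : R) (m : nat).
Local Notation mu := (completed_mu R).

(** What membership in the space of the statement means for the real and for the
    imaginary part. Asking for
    integrability of the product itself, for every upper bound of the interval,
    makes closure under linear operations immediate. *)
Definition log_integrable g := forall x m,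
  mu.-integrable `]0, x] (fun t => (g t * ln t ^+ m)%:E).

Lemma log_integrable_itv g x : log_integrable g ->
  mu.-integrable `]0, x] (EFin \o g).
Proof.
move=> /(_ x 0%N); apply: eq_integrable; first exact: measurable_itv_lebesgue.
by move=> t _; rewrite expr0 mulr1.
Qed.

Lemma eq_log_integrable g h : (forall t, 0 < t -> g t = h t) ->
  log_integrable g -> log_integrable h.
Proof.
move=> gh gi x m; apply: eq_integrable (gi x m).
  exact: measurable_itv_lebesgue.
by move=> t; rewrite inE/= in_itv/= => /andP[t0 _]; rewrite gh.
Qed.

Lemma log_integrableD g h : log_integrable g -> log_integrable h ->
  log_integrable (fun t => g t + h t).
Proof.
move=> gi hi x m.
have := integrableD (measurable_itv_lebesgue _) (gi x m) (hi x m).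
by apply: eq_integrable => [|t _]; [exact: measurable_itv_lebesgue|
  rewrite /= mulrDl EFinD].
Qed.

Lemma log_integrableZ (k : R) g : log_integrable g ->
  log_integrable (fun t => k * g t).
Proof.
move=> gi x m.
have := integrableZl (measurable_itv_lebesgue _) k (gi x m).
by apply: eq_integrable => [|t _]; [exact: measurable_itv_lebesgue|
  rewrite /= -EFinM mulrA].
Qed.

Lemma log_integrable_norm g : log_integrable g ->
  log_integrable (fun t => `|g t|).
Proof.
move=> gi x m.
have mD := measurable_itv_lebesgue `]0, x].
apply: (le_integrable mD _ _ (gi x m)); last first.
  by move=> t _; rewrite /= lee_fin !normrM normr_id.
apply/measurable_EFinP; apply: measurable_funM.
  apply: measurableT_comp => //; apply/measurable_EFinP.
  exact: (measurable_int mu (log_integrable_itv x gi)).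
apply: measurable_funX.
apply: (@measurable_fun_borel_lebesgue R _ R _ (@ln R)).
  exact: measurable_itv.
exact: measurable_funTS.
Qed.

Lemma log_integrable_ln g : log_integrable g ->
  log_integrable (fun t => g t * ln t).
Proof.
move=> gi x m; apply: eq_integrable (gi x m.+1).
  exact: measurable_itv_lebesgue.
by move=> t _; rewrite exprS mulrA.
Qed.

(** The weight produced by Fubini below. It is handled by induction on the
    exponent because log-integrability is stable under multiplication by the
    logarithm. *)
Lemma log_integrable_norm_ln (K : R) n g : log_integrable g ->
  log_integrable (fun t => `|g t| * (K + `|ln t|) ^+ n).
Proof.
elim: n g => [|n IH] g gi.
  apply: eq_log_integrable (log_integrable_norm gi) => t _.
  by rewrite expr0 mulr1.
have g1 := IH _ gi.
have h1 := IH _ (log_integrable_ln gi).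
apply: eq_log_integrable (log_integrableD (log_integrableZ K g1) h1) => t _.
by rewrite normrM exprS; ring.
Qed.

Lemma integral_inv (a b : R) : 0 < a -> a <= b ->
  (\int[mu]_(t in `[a, b]) (t^-1)%:E = (ln b - ln a)%:E)%E.
Proof.
move=> a0 ab.
have cinv (t : R) : 0 < t -> {for t, continuous (@GRing.inv R)}.
  by move=> t0; apply: inv_continuous; rewrite gt_eqF.
have cont : {within `[a, b], continuous (@GRing.inv R)}.
  apply: continuous_in_subspaceT => t; rewrite inE/= in_itv/= => /andP[at_ _].
  by apply: cinv; exact: lt_le_trans at_.
rewrite integral_completed//; last first.
  apply/measurable_EFinP; apply: subspace_continuous_measurable_fun => //.
move: ab; rewrite le_eqVlt => /predU1P[<-|ab].
  by rewrite set_itv1 integral_set1 subrr.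
rewrite (@continuous_FTC2 _ _ (@ln R))//.
- split.
  + move=> t; rewrite in_itv/= => /andP[at_ _].
    by apply: ex_derive; apply: is_derive1_ln; exact: lt_trans at_.
  + by apply: cvg_at_right_filter; apply: continuous_ln.
  + by apply: cvg_at_left_filter; apply: continuous_ln; exact: lt_trans ab.
- move=> t; rewrite in_itv/= => /andP[at_ _].
  by rewrite derive1E; apply: derive_val; apply: is_derive1_ln; exact: lt_trans at_.
Qed.

End log_integrable.

(** * The real Cesaro operator preserves log-integrability *)

Section real_cesaro.
Context {R : realType}.
Implicit Types (g h : R -> R) (x : R) (m : nat).
Local Notation mu := (completed_mu R).

(** Powers and logarithms are regular only on the open half-line, hence the
    restriction to intervals it contains. *)
Lemma measurable_continuous_itv (w : R -> R) (i : interval R) :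
  [set` i] `<=` `]0, +oo[ -> (forall t : R, 0 < t -> {for t, continuous w}) ->
  measurable_fun ([set` i] : set R) w.
Proof.
move=> i0 cw; apply: measurable_funS i0 _; first exact: measurable_itv.
apply: open_continuous_measurable_fun; first exact: interval_open.
by move=> t; rewrite inE/= in_itv/= andbT => /cw.
Qed.

Lemma continuous_inv (t : R) : 0 < t -> {for t, continuous (@GRing.inv R)}.
Proof. by move=> t0; apply: inv_continuous; rewrite gt_eqF. Qed.

Lemma ler_norm_between (a b c : R) : a <= b -> b <= c ->
  `|b| <= `|c| + `|a|.
Proof.
move=> ab bc; have := ler_norm (- a); rewrite normrN => aN.
have := (ler_norm c, normr_ge0 a, normr_ge0 c) => -[[cN a0] c0].
by rewrite ler_norml; apply/andP; split; lra.
Qed.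

Definition cesaroR g : R -> R := fun x => x^-1 * \int[mu]_(t in `]0, x]) g t.

(** The reason why the space asks for every power of the logarithm: by Tonelli,
    the integral over ]0, X] of |ln t|^m / t times the integral of |g| over
    ]0, t] is the integral of |g s| times the integral over [s, X] of
    |ln t|^m / t. The latter is at most (|ln X| + |ln s|)^(m+1), so averaging
    costs one power of the logarithm. Fubini then also provides measurability
    of the average. *)
Lemma log_integrable_cesaroR g : log_integrable g -> log_integrable (cesaroR g).
Proof.
move=> gi X m.
have mD : measurable (`]0, X]%classic : set (lebesgueTypeR R)).
  exact: measurable_itv_lebesgue.
pose g0 : lebesgueTypeR R -> R := g \_ `]0, X].
pose h (t : R) := t^-1 * ln t ^+ m.
pose h0 : lebesgueTypeR R -> R := h \_ `]0, X].
pose below : set (lebesgueTypeR R * lebesgueTypeR R) :=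
  [set z | (z.2 : R) <= z.1].
(* The cut-offs confine G to the triangle 0 < s <= t <= X, t coming first. *)
pose G (z : lebesgueTypeR R * lebesgueTypeR R) := h0 z.1 * g0 z.2 * \1_below z.
have mid : measurable_fun setT (id : lebesgueTypeR R -> R).
  by move=> _ A mA; rewrite setTI; exact: borel_lebesgue_measurable.
have mg0 : measurable_fun setT g0.
  apply/(@measurable_restrictT _ _ (lebesgueTypeR R) R _ g mD)/measurable_EFinP.
  exact: (measurable_int mu (log_integrable_itv X gi)).
have mh0 : measurable_fun setT h0.
  apply/(@measurable_restrictT _ _ (lebesgueTypeR R) R _ h mD).
  apply: (@measurable_fun_borel_lebesgue R _ R).
    exact: measurable_itv.
  apply: measurable_funM.
    apply: measurable_continuous_itv; last exact: continuous_inv.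
    by move=> t /=; rewrite !in_itv/= => /andP[->].
  by apply: measurable_funX; exact: measurable_funTS.
have mbelow : measurable below.
  have := @measurable_fun_ler _ _ R setT
    (fun z : lebesgueTypeR R * lebesgueTypeR R => z.2 : R)
    (fun z : lebesgueTypeR R * lebesgueTypeR R => z.1 : R)
    (measurableT_comp mid measurable_snd)
    (measurableT_comp mid measurable_fst).
  move=> /(_ measurableT [set true] I); rewrite setTI.
  by congr (measurable _); apply/seteqP; split=> z.
have inbelow t s : ((t, s) \in below) = (s <= t).
  by apply/idP/idP; rewrite inE.
have mG : measurable_fun setT (EFin \o G).
  apply/measurable_EFinP; apply: measurable_funM; last exact: measurable_indic.
  by apply: measurable_funM;
    [exact: measurableT_comp mh0 measurable_fst|
     exact: measurableT_comp mg0 measurable_snd].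
pose K (s : R) := `|g s| * (`|ln X| + `|ln s|) ^+ m.+1.
have iK : mu.-integrable `]0, X] (EFin \o K).
  exact: log_integrable_itv (log_integrable_norm_ln _ _ gi).
have [_ iG] := @integrable21ltyP _ _ _ _ R mu mu _ mG.
have : mu.-integrable setT (fubini_F mu (EFin \o G)).
  apply: integrable_fubini_F; apply: iG.
  have iK' := (integrable_mkcond _ mD).1 iK.
  apply: (le_lt_trans _ (integrable_lty measurableT iK')).
  apply: ge0_le_integral; first exact: measurableT.
  - by move=> s _; exact: integral_ge0.
  - apply: (@measurable_fun_fubini_tonelli_G _ _ _ _ R mu (abse \o (EFin \o G))).
      exact: measurableT_comp.
    by move=> z; rewrite lee_fin/=.
  - exact: (measurable_int mu iK').
  - move=> s _; rewrite patchE; case: ifPn => [|sX]; last first.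
      rewrite integral0_eq// => t _.
      by rewrite /= /G /= /g0 patchE (negbTE sX) mulr0 mul0r normr0.
    rewrite inE/= in_itv/= => /andP[s0 sX].
    (* On [s, X] the values of |ln| are at most |ln X| + |ln s|. *)
    pose c := `|g s| * (`|ln X| + `|ln s|) ^+ m.
    have c0 : 0 <= c by rewrite mulr_ge0// exprn_ge0// addr_ge0.
    have msX : measurable (`[s, X]%classic : set (lebesgueTypeR R)).
      exact: measurable_itv_lebesgue.
    have minv : measurable_fun (`[s, X]%classic : set (lebesgueTypeR R))
        (fun t : lebesgueTypeR R => (t : R)^-1).
      apply: (@measurable_fun_borel_lebesgue R _ R); first exact: measurable_itv.
      apply: measurable_continuous_itv; last exact: continuous_inv.
      move=> t /=; rewrite !in_itv/= andbT => /andP[st _].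
      exact: lt_le_trans st.
    apply: (@le_trans _ _ (\int[mu]_(t in `[s, X]) (c * t^-1)%:E)%E).
      rewrite [leRHS]integral_mkcond.
      apply: ge0_le_integral; first exact: measurableT.
      + by [].
      + apply/measurable_EFinP; apply: measurableT_comp; first exact: normr_measurable.
        apply: measurableT_comp (measurable_pair2 s).
        exact/measurable_EFinP.
      + apply: ((@measurable_restrictT _ _ (lebesgueTypeR R) _ _ _ msX).1 _).
        by apply/measurable_EFinP; exact: measurable_funM.
      + move=> t _; rewrite [leRHS]patchE /G/= indicE inbelow.
        have [st|ts] := leP s t; last first.
          rewrite mulr0 normr0 memNset//= in_itv/= leNgt ts.
          by [].
        rewrite mulr1 /h0 patchE.
        have [tX|Xt] := leP t X; last first.
          rewrite memNset/=; last by rewrite in_itv/= (leNgt t) Xt andbF.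
          by rewrite mul0r normr0 memNset//= in_itv/= (leNgt t) Xt andbF.
        have t0 : 0 < t by exact: lt_le_trans st.
        rewrite mem_set/=; last by rewrite in_itv/= t0 tX.
        rewrite mem_set/=; last by rewrite in_itv/= st tX.
        rewrite /g0 patchE mem_set/=; last by rewrite in_itv/= s0 sX.
        rewrite lee_fin /h !normrM normrX gtr0_norm ?invr_gt0//.
        rewrite -mulrA [leRHS]mulrC.
        rewrite ler_pM2l ?invr_gt0// /c mulrC ler_wpM2l// lerXn2r ?nnegrE//.
        have lst : ln s <= ln t by rewrite ler_ln.
        have ltX : ln t <= ln X by rewrite ler_ln// posrE (lt_le_trans t0).
        exact: ler_norm_between.
    under eq_integral do rewrite EFinM.
    rewrite (ge0_integralZl mu msX); last first.
    + by rewrite lee_fin.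
    + by move=> t /=; rewrite in_itv/= lee_fin invr_ge0 => /andP[st _];
        rewrite (le_trans _ st)// ltW.
    + exact/measurable_EFinP.
    rewrite integral_inv// -EFinM lee_fin /K /c exprSr mulrA ler_wpM2l//.
    by rewrite (le_trans (ler_norm _))// ler_normB.
move=> /(integrableS measurableT mD (@subsetT _ _)).
apply: eq_integrable => // t; change (Real.sort R) in t; rewrite inE/= => tX.
move: (tX); rewrite in_itv/= => /andP[t0 tX'].
rewrite /fubini_F /=.
(* The partial integral at t is the average times the weight. *)
transitivity (\int[mu]_(s in `]0%R, t]) ((h t)%:E * (g s)%:E))%E.
  rewrite [RHS]integral_mkcond; apply: eq_integral => s _.
  rewrite /G/= [in RHS]patchE /h0 patchE mem_set// /g0 patchE indicE inbelow.
  have [st|ts] := leP (s : R) t; last first.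
    rewrite mulr0 (@memNset _ `]0, t])//=.
    by rewrite in_itv/= (leNgt s) ts andbF.
  rewrite mulr1.
  have [s0|s0] := ltP 0 (s : R); last first.
    by rewrite !memNset/= ?mulr0// in_itv/= (ltNge 0) s0.
  by rewrite !mem_set//= in_itv/= s0 (le_trans st).
have mt := measurable_itv_lebesgue `]0, t].
have it := log_integrable_itv t gi.
rewrite integralZl// /cesaroR -[X in (_ * X)%E]fineK; last exact: integrable_fin_num.
by rewrite -EFinM; congr (_%:E); rewrite /h mulrAC.
Qed.

End real_cesaro.

(** * Improper integrals at the origin *)

Section improper_integrals.
Context {R : realType}.
Local Notation mu := (completed_mu R).

(** Any power is beaten by any exponential; applied to a logarithm, it makes
    ln^m negligible against arbitrarily small powers, at 0 and at infinity. *)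
Lemma expr_le_expR n (d : R) : 0 < d ->
  exists2 K : R, 0 < K & forall y : R, `|y| ^+ n <= K * expR (d * `|y|).
Proof.
move=> d0; have K0 : 0 < n`!%:R / d ^+ n.
  by rewrite divr_gt0 ?exprn_gt0// ltr0n fact_gt0.
exists (n`!%:R / d ^+ n) => // y.
have dy : 0 <= d * `|y| by rewrite mulr_ge0// ltW.
suff : (d * `|y|) ^+ n <= n`!%:R * expR (d * `|y|).
  by rewrite exprMn mulrAC ler_pdivlMr ?exprn_gt0// mulrC.
rewrite [leRHS]mulrC -ler_pdivrMr ?ltr0n ?fact_gt0//; case: n {K0} => [|n].
  have -> : 0`!%:R = 1 :> R by [].
  by rewrite expr0 divr1 (le_trans _ (expR_ge1Dx _))// lerDl.
by rewrite (le_trans _ (expR_ge1Dxn n dy))// lerDr.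
Qed.

(** A nonnegative integrand needs no a priori integrability at 0: the
    fundamental theorem holds on [x / (n+2), x] and monotone convergence passes
    to the union of these intervals. *)
Lemma ge0_improper_FTC (w W : R -> R) (x : R) : 0 < x ->
  (forall t : R, 0 < t -> is_derive t 1 W (w t)) ->
  (forall t : R, 0 < t -> {for t, continuous w}) ->
  (forall t : R, 0 < t <= x -> 0 <= w t) ->
  W t @[t --> 0^'+] --> 0 ->
  (@lebesgue_measure R).-integrable `]0, x] (EFin \o w) /\
  (\int[lebesgue_measure]_(t in `]0%R, x]) (w t)%:E = (W x)%:E)%E.
Proof.
move=> x0 dW cw w0 W0.
(* The shift by 2 keeps every left endpoint strictly below x. *)
pose a (n : nat) : R := x / n.+2%:R.
have a0 n : 0 < a n by rewrite divr_gt0.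
have ax n : a n < x by rewrite ltr_pdivrMr// ltr_pMr// ltr1n.
have cW (t : R) : 0 < t -> {for t, continuous W}.
  move=> t0; apply: differentiable_continuous; apply/derivable1_diffP.
  by have [] := dW _ t0.
have FTC n : (\int[lebesgue_measure]_(t in `[a n, x]) (w t)%:E =
    (W x)%:E - (W (a n))%:E)%E.
  apply: continuous_FTC2 => //.
  - apply: continuous_in_subspaceT => t; rewrite inE/= in_itv/= => /andP[at_ _].
    by apply: cw; exact: lt_le_trans at_.
  - split.
    + move=> t; rewrite in_itv/= => /andP[at_ _].
      by have [] := dW t (lt_trans (a0 n) at_).
    + by apply: cvg_at_right_filter; exact: cW.
    + by apply: cvg_at_left_filter; exact: cW.
  - move=> t; rewrite in_itv/= => /andP[at_ _].
    rewrite derive1E; apply: derive_val; apply: dW; exact: lt_trans at_.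
have Fcup : (\bigcup_n `[a n, x])%classic = `]0, x]%classic.
  apply/seteqP; split=> t /=.
    by move=> [n _ /=]; rewrite !in_itv/= => /andP[at_ ->];
      rewrite andbT (lt_le_trans _ at_).
  rewrite in_itv/= => /andP[t0 tx].
  have [n _ nlt] : exists2 n : nat, True & x / t <= n.+2%:R.
    exists (Num.truncn (x / t)) => //.
    have := truncnS_gt (x / t) => /ltW /le_trans; apply.
    by rewrite ler_nat.
  exists n => //=; rewrite in_itv/= tx andbT /a ler_pdivrMr// mulrC -ler_pdivrMr//.
have a_cvg : a n @[n --> \oo] --> 0.
  rewrite -(mulr0 x); apply: cvgMl_tmp.
  by have := @cvg_harmonic R; rewrite -(cvg_shiftS (harmonic : nat -> R)).
have Wa : W (a n) @[n --> \oo] --> 0 by apply: (cvg_at_rightP _ _ _).1 W0 _ _.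
have int_lim : (\int[lebesgue_measure]_(t in `]0%R, x]) (w t)%:E = (W x)%:E)%E.
  rewrite -Fcup.
  have nd : nondecreasing_seq (fun n => `[a n, x]%classic).
    move=> i j ij; apply/subsetPset => t /=; rewrite !in_itv/= => /andP[+ ->].
    rewrite andbT; apply: le_trans; rewrite /a ler_pM2l// lef_pV2 ?posrE ?ltr0n//.
    by rewrite ler_nat !ltnS.
  have mwa n : measurable_fun `[a n, x] (EFin \o w).
    apply/measurable_EFinP; apply: measurable_continuous_itv cw => t /=.
    by rewrite !in_itv/= andbT => /andP[+ _]; exact: lt_le_trans.
  have w0' n t : `[a n, x]%classic t -> (0 <= (EFin \o w) t)%E.
    move=> /=; rewrite in_itv/= => /andP[at_ tx].
    by rewrite lee_fin w0// tx (lt_le_trans _ at_).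
  have /cvg_lim <- // := @ge0_nondecreasing_set_cvg_integral _
    (measurableTypeR R) R _ _ (@lebesgue_measure R) nd
    (fun n => measurable_itv _) mwa w0'.
  have /cvg_lim : ((W x)%:E - (W (a n))%:E)%E @[n --> \oo] --> ((W x)%:E - 0%:E)%E.
    apply/fine_cvgP; split; first by apply: nearW.
    by apply: (@cvgB _ _ _ _ _ (fun=> W x) (W \o a)) => //; exact: cvg_cst.
  by rewrite sube0 -(funext FTC) => <-.
split=> //; apply/integrableP; split.
  by apply/measurable_EFinP; apply: measurable_continuous_itv cw => t /=;
    rewrite !in_itv/= => /andP[->].
under eq_integral => t.
  rewrite inE/= in_itv/= => tx; rewrite /= ger0_norm ?w0//; over.
by rewrite int_lim ltry.
Qed.

End improper_integrals.

(** * Powers with oscillation and logarithms *)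

Section oscillating_powers.
Context {R : realType}.
Local Notation mu := (completed_mu R).
Implicit Types (a b p q x : R) (m : nat).

(** The real and imaginary parts of t^(a + ib) (ln t)^m are the cases
    (p, q) = (1, 0) and (0, 1). With p and q free, the span of the family is
    stable under t d/dt, which acts on (p, q) through the quarter turn
    (p, q) |-> (q, - p). *)
Definition osc_pow a b p q m (t : R) : R :=
  expR (a * ln t) * (p * cos (b * ln t) + q * sin (b * ln t)) * ln t ^+ m.

Lemma is_derive_osc_pow a b p q m (t : R) : 0 < t ->
  is_derive t 1 (osc_pow a b p q m)
    ((a * osc_pow a b p q m t + b * osc_pow a b q (- p) m t
      + m%:R * osc_pow a b p q m.-1 t) / t).
Proof.
move=> t0; have dln : is_derive t 1 (@ln R) t^-1 by exact: is_derive1_ln.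
have dlin c : is_derive t 1 (fun t => c * ln t) (c / t).
  by have := is_deriveZ c dln.
have de : is_derive t 1 (fun t => expR (a * ln t)) (expR (a * ln t) * (a / t)).
  exact: (@is_derive1_comp _ expR (fun t => a * ln t)).
have dc : is_derive t 1 (fun t => cos (b * ln t)) (- sin (b * ln t) * (b / t)).
  exact: (@is_derive1_comp _ cos (fun t => b * ln t)).
have ds : is_derive t 1 (fun t => sin (b * ln t)) (cos (b * ln t) * (b / t)).
  exact: (@is_derive1_comp _ sin (fun t => b * ln t)).
have dpc := is_deriveZ p dc.
have dqs := is_deriveZ q ds.
have := is_deriveM (is_deriveM de (is_deriveD dpc dqs)) (is_deriveX m dln).
set F := (X in is_derive _ _ X _).
have -> : F = osc_pow a b p q m by apply/funext => s; rewrite /F !fctE.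
rewrite {}/F => dF; apply: is_derive_eq; rewrite /osc_pow !fctE /GRing.scale/=.
by case: m {dF} => [|m] /=; rewrite ?exprS /GRing.scale/=; field; rewrite gt_eqF.
Qed.

Lemma continuous_osc_pow a b p q m (t : R) : 0 < t ->
  {for t, continuous (osc_pow a b p q m)}.
Proof.
move=> t0; apply: differentiable_continuous; apply/derivable1_diffP.
by have [] := is_derive_osc_pow a b p q m t0.
Qed.

Lemma osc_pow_le a b p q m (t : R) :
  `|osc_pow a b p q m t| <= (`|p| + `|q|) * (`|ln t| ^+ m * expR (a * ln t)).
Proof.
rewrite /osc_pow !normrM normrX (gtr0_norm (expR_gt0 _)) mulrAC -mulrA mulrC.
rewrite [X in X * _ <= _]mulrC -mulrA; set y := ln t.
rewrite ler_wpM2r// ?mulr_ge0 ?exprn_ge0 ?expR_ge0//.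
rewrite (le_trans (ler_normD _ _))// lerD// normrM ler_piMr//.
  by rewrite ler_norml cos_geN1 cos_le1.
by rewrite ler_norml sin_geN1 sin_le1.
Qed.

(** Half of the distance from a to -1 is spent on absorbing the logarithms. The
    exponent obtained depends on a only, so that all the functions in the
    derivative of t * osc_pow have, up to constants, one integrable majorant. *)
Lemma osc_pow_bound a b p q m x : -1 < a ->
  exists2 k : R, 0 <= k & forall t, 0 < t <= x ->
    `|osc_pow a b p q m t| <= k * expR ((a - 1) / 2 * ln t).
Proof.
move=> a1; pose d := (a + 1) / 2.
have d0 : 0 < d by rewrite /d; lra.
have -> : (a - 1) / 2 = a - d by rewrite /d; field.
clearbody d; have [K K0 HK] := expr_le_expR m d0.
exists ((`|p| + `|q|) * K * expR (2 * d * `|ln x|)).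
  by rewrite !mulr_ge0// ?addr_ge0// ?expR_ge0// ltW.
move=> t /andP[t0 tx]; rewrite (le_trans (osc_pow_le _ _ _ _ _ _))//.
rewrite -!mulrA ler_wpM2l ?addr_ge0//.
rewrite (@le_trans _ _ (K * expR (d * `|ln t|) * expR (a * ln t)))//.
  by rewrite ler_wpM2r// expR_ge0.
rewrite -mulrA ler_wpM2l ?(ltW K0)// -!expRD ler_expR.
have lx : ln t <= `|ln x|.
  by rewrite (le_trans _ (ler_norm _))// ler_ln// posrE (lt_le_trans t0).
have hx : d * ln t <= d * `|ln x| by rewrite ler_wpM2l// ltW.
have hx0 : 0 <= d * `|ln x| by rewrite mulr_ge0// ltW.
case: (leP 0 (ln t)) => h; last by rewrite ltr0_norm//; lra.
by rewrite ger0_norm//; lra.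
Qed.

Lemma cvg_expR_Ny (F : set_system R) {FF : Filter F} (g : R -> R) :
  g t @[t --> F] --> -oo -> expR (g t) @[t --> F] --> (0 : R).
Proof.
move=> /cvgNry gy; apply: cvg_trans (cvg_comp _ _ gy (@cvgr_expR R)).
by apply: near_eq_cvg; apply: nearW => t /=; rewrite opprK.
Qed.

Lemma cvg0_mulr (F : set_system R) {FF : Filter F} (k : R) (g : R -> R) :
  g t @[t --> F] --> 0 -> k * g t @[t --> F] --> 0.
Proof. by move=> /(@cvgMl_tmp _ _ _ _ _ k); rewrite mulr0. Qed.

Lemma cvg_expR_ln_0 c : 0 < c -> expR (c * ln t) @[t --> 0^'+] --> (0 : R).
Proof.
by move=> c0; apply: cvg_expR_Ny; apply: gt0_cvgMrNy => //; exact: lnNy.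
Qed.

Lemma mul_expR_ln c (t : R) : 0 < t -> t * expR (c * ln t) = expR ((c + 1) * ln t).
Proof. by move=> t0; rewrite mulrDl mul1r expRD lnK// mulrC. Qed.

Lemma is_derive_mul_osc_pow a b p q m (t : R) : 0 < t ->
  is_derive t 1 (fun s => s * osc_pow a b p q m s)
    ((a + 1) * osc_pow a b p q m t + b * osc_pow a b q (- p) m t
      + m%:R * osc_pow a b p q m.-1 t).
Proof.
move=> t0.
have dF := is_deriveM (is_derive_id t 1) (is_derive_osc_pow a b p q m t0).
apply: (@is_derive_eq _ _ _ _ _ _ _ _ dF); rewrite /GRing.scale/=.
by field; rewrite gt_eqF.
Qed.

Lemma is_derive_expR_ln c (t : R) : 0 < t ->
  is_derive t 1 (fun s => expR (c * ln s)) (expR (c * ln t) * (c / t)).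
Proof.
move=> t0; have dln : is_derive t 1 (@ln R) t^-1 by exact: is_derive1_ln.
have dlin := is_deriveZ c dln.
exact: (@is_derive1_comp _ expR (fun t => c * ln t)).
Qed.

Lemma is_derive_primitive_expR_ln c (t : R) : c + 1 != 0 -> 0 < t ->
  is_derive t 1 (fun s => (c + 1)^-1 * expR ((c + 1) * ln s)) (expR (c * ln t)).
Proof.
move=> c1 t0; have dF := is_deriveZ (c + 1)^-1 (is_derive_expR_ln (c + 1) t0).
apply: (@is_derive_eq _ _ _ _ _ _ _ _ dF); rewrite /GRing.scale/= -mul_expR_ln//.
by field; rewrite c1 gt_eqF.
Qed.

Lemma integral_expR_ln c x : -1 < c -> 0 < x ->
  (@lebesgue_measure R).-integrable `]0, x] (EFin \o (fun t => expR (c * ln t)))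
  /\ (\int[lebesgue_measure]_(t in `]0%R, x]) (expR (c * ln t))%:E =
      ((c + 1)^-1 * expR ((c + 1) * ln x))%:E)%E.
Proof.
move=> c1 x0; have c10 : 0 < c + 1 by lra.
have dV (t : R) : 0 < t -> is_derive t 1
    (fun s => (c + 1)^-1 * expR ((c + 1) * ln s)) (expR (c * ln t)).
  by move=> t0; apply: is_derive_primitive_expR_ln; rewrite ?gt_eqF.
have cv (t : R) : 0 < t -> {for t, continuous (fun t => expR (c * ln t))}.
  move=> t0; apply: differentiable_continuous; apply/derivable1_diffP.
  by have [] := is_derive_expR_ln c t0.
have v0 (t : R) : 0 < t <= x -> 0 <= expR (c * ln t) by rewrite expR_ge0.
apply: (ge0_improper_FTC x0 dV cv v0).
exact: (cvg0_mulr _ (cvg_expR_ln_0 c10)).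
Qed.

Lemma integrable_osc_pow a b p q m x : -1 < a ->
  (@lebesgue_measure R).-integrable `]0, x] (EFin \o osc_pow a b p q m).
Proof.
move=> a1; have [x0|x0] := leP x 0.
  by rewrite set_itv_ge ?bnd_simp -?leNgt//; exact: integrable_set0.
have [k k0 Hk] := osc_pow_bound b p q m x a1.
have c1 : -1 < (a - 1) / 2 by lra.
have [iv _] := integral_expR_ln c1 x0.
have mD : measurable (`]0, x]%classic : set (measurableTypeR R)).
  exact: measurable_itv.
apply: (le_integrable mD _ _ (integrableZl mD k iv)).
  apply/measurable_EFinP; apply: measurable_continuous_itv.
    by move=> t /=; rewrite !in_itv/= => /andP[->].
  by move=> t; exact: continuous_osc_pow.
move=> t /=; rewrite in_itv/= => tx; rewrite lee_fin.
by rewrite (le_trans (Hk _ tx))// ler_norm.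
Qed.

(** The right-hand side integrates the derivative of t * osc_pow. Since this
    derivative changes sign, the nonnegative fundamental theorem is applied after
    adding a multiple of the majorant, whose own primitive is explicit. *)
Lemma integral_osc_pow a b p q m x : -1 < a -> 0 < x ->
  x * osc_pow a b p q m x =
    (a + 1) * \int[lebesgue_measure]_(t in `]0, x]) osc_pow a b p q m t
    + b * \int[lebesgue_measure]_(t in `]0, x]) osc_pow a b q (- p) m t
    + m%:R * \int[lebesgue_measure]_(t in `]0, x]) osc_pow a b p q m.-1 t.
Proof.
move=> a1 x0; have c1 : -1 < (a - 1) / 2 by lra.
have mD : measurable (`]0, x]%classic : set (measurableTypeR R)).
  exact: measurable_itv.
have [k1 k10 H1] := osc_pow_bound b p q m x a1.
have [k2 k20 H2] := osc_pow_bound b q (- p) m x a1.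
have [k3 k30 H3] := osc_pow_bound b p q m.-1 x a1.
pose k := `|a + 1| * k1 + `|b| * k2 + m%:R * k3.
pose c := (a - 1) / 2; rewrite -/c in c1 H1 H2 H3.
pose w t := (a + 1) * osc_pow a b p q m t + b * osc_pow a b q (- p) m t
      + m%:R * osc_pow a b p q m.-1 t.
pose v t := expR (c * ln t).
pose V t := (c + 1)^-1 * expR ((c + 1) * ln t).
have iw1 := integrable_osc_pow b p q m x a1.
have iw2 := integrable_osc_pow b q (- p) m x a1.
have iw3 := integrable_osc_pow b p q m.-1 x a1.
have iw : (@lebesgue_measure R).-integrable `]0, x] (EFin \o w).
  have := integrableD mD (integrableD mD (integrableZl mD (a + 1) iw1)
    (integrableZl mD b iw2)) (integrableZl mD m%:R iw3).
  by apply: eq_integrable => // t _; rewrite /w /= !EFinD !EFinM.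
have [iv intv] := integral_expR_ln c1 x0.
have c10 : 0 < c + 1 by lra.
have dV (t : R) : 0 < t -> is_derive t 1 V (v t).
  by move=> t0; apply: is_derive_primitive_expR_ln; rewrite ?gt_eqF.
have dWV (t : R) : 0 < t ->
    is_derive t 1 (fun s => s * osc_pow a b p q m s + k * V s) (w t + k * v t).
  move=> t0; have := is_deriveD (is_derive_mul_osc_pow a b p q m t0)
    (is_deriveZ k (dV t t0)).
  exact.
have [] := @ge0_improper_FTC R (fun t => w t + k * v t) _ x x0 dWV.
- move=> t t0; apply: cvgD; last first.
    apply: cvgMl_tmp; apply: differentiable_continuous; apply/derivable1_diffP.
    by have [] := is_derive_expR_ln c t0.
  by apply: cvgD; [apply: cvgD|]; apply: cvgMl_tmp; exact: continuous_osc_pow.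
- move=> t tx; rewrite -(opprK (w t)) addrC subr_ge0 (le_trans (ler_norm _))//.
  have -> : k * v t = `|a + 1| * (k1 * v t) + `|b| * (k2 * v t) + m%:R * (k3 * v t).
    by rewrite /k; ring.
  rewrite normrN /w (le_trans (ler_normD _ _))// lerD//; last first.
    by rewrite normrM normr_nat ler_wpM2l//; exact: H3.
  rewrite (le_trans (ler_normD _ _))// lerD// normrM ler_wpM2l//; first exact: H1.
  exact: H2.
- suff WV0 : t * osc_pow a b p q m t @[t --> 0^'+] --> 0.
    have h := cvgD WV0 (cvg0_mulr k (cvg0_mulr (c + 1)^-1 (cvg_expR_ln_0 c10))).
    by rewrite addr0 in h; exact: h.
  apply: norm_cvg0.
  have u0 : k1 * expR ((c + 1) * ln t) @[t --> 0^'+] --> (0 : R).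
    exact: (cvg0_mulr _ (cvg_expR_ln_0 c10)).
  apply: (squeeze_cvgr _ (cvg_cst 0) u0).
  near=> t; have t0 : 0 < t by near: t; exact: nbhs_right_gt.
  have tx : t <= x by near: t; exact: nbhs_right_le.
  rewrite normr_ge0/= normrM gtr0_norm// -mul_expR_ln// mulrCA ler_pM2l//.
  by apply: H1; rewrite t0 tx.
move=> _ intwv.
have : \int[lebesgue_measure]_(t in `]0, x]) w t = x * osc_pow a b p q m x.
  apply: (addIr (k * V x)).
  rewrite -[RHS]/(fine (x * osc_pow a b p q m x + k * V x)%:E) -intwv.
  have -> : k * V x = \int[lebesgue_measure]_(t in `]0, x]) (k * v t).
    by rewrite (RintegralZl k mD iv) /Rintegral intv.
  rewrite -RintegralD//.
  by have := integrableZl mD k iv; apply: eq_integrable.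
move=> <-; rewrite /w RintegralD//; last 2 first.
- have := integrableD mD (integrableZl mD (a + 1) iw1) (integrableZl mD b iw2).
  by apply: eq_integrable.
- by have := integrableZl mD m%:R iw3; apply: eq_integrable.
rewrite RintegralD//; last 2 first.
- by have := integrableZl mD (a + 1) iw1; apply: eq_integrable.
- by have := integrableZl mD b iw2; apply: eq_integrable.
by rewrite !RintegralZl.
Unshelve. all: by end_near. Qed.

Lemma cvg_ln_pinfty : ln x @[x --> +oo] --> (+oo : set_system R).
Proof.
apply/cvgryPge => y; near=> t.
have yt : expR y <= t by near: t; apply: nbhs_pinfty_ge; exact: num_real.
by rewrite -ler_expR lnK// posrE (lt_le_trans _ yt)// expR_gt0.
Unshelve. all: by end_near. Qed.

(** These are the terms whose exponent has a negative real part: they vanish at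
    infinity whether or not they are integrable at 0. *)
Lemma cvg_osc_pow_pinfty a b p q m : a < 0 ->
  osc_pow a b p q m x @[x --> +oo] --> (0 : R).
Proof.
move=> a0; pose d := - a / 2.
have d0 : 0 < d by rewrite /d; lra.
have [K K0 HK] := expr_le_expR m d0.
pose k := (`|p| + `|q|) * K.
apply: norm_cvg0.
have u0 : k * expR (a / 2 * ln t) @[t --> +oo] --> (0 : R).
  apply: cvg0_mulr; apply: cvg_expR_Ny; apply/cvgNry.
  rewrite (_ : - _ = fun t => d * ln t); last first.
    by apply/funext => t; rewrite fctE /d; field.
  by apply: gt0_cvgMry => //; exact: cvg_ln_pinfty.
apply: (squeeze_cvgr _ (cvg_cst 0) u0).
near=> t; have t1 : 1 <= t by near: t; apply: nbhs_pinfty_ge; exact: num_real.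
rewrite normr_ge0/= (le_trans (osc_pow_le _ _ _ _ _ _))// /k -mulrA.
rewrite ler_wpM2l ?addr_ge0//.
rewrite (@le_trans _ _ (K * expR (d * `|ln t|) * expR (a * ln t)))//.
  by rewrite ler_wpM2r// expR_ge0.
rewrite -mulrA ler_wpM2l ?(ltW K0)// -expRD ler_expR ger0_norm ?ln_ge0//.
by rewrite le_eqVlt; apply/orP; left; apply/eqP; rewrite /d; field.
Unshelve. all: by end_near. Qed.

End oscillating_powers.

(** * Regularity of the real Cesaro operator *)

Section regularity.
Context {R : realType}.
Local Notation mu := (completed_mu R).

Lemma log_integrable_osc_pow (a b p q : R) m : -1 < a ->
  log_integrable (osc_pow a b p q m).
Proof.
move=> a1 x n.
have mD : measurable (`]0, x]%classic : set (measurableTypeR R)).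
  exact: measurable_itv.
have := integrable_completed mD (integrable_osc_pow b p q (m + n) x a1).
apply: eq_integrable; first exact: measurable_itv_lebesgue.
by move=> t _; rewrite /= /osc_pow exprD mulrA.
Qed.

Lemma log_integrable_cst (k : R) : log_integrable (fun=> k).
Proof.
have := log_integrable_osc_pow 0 k 0 0 (ltrN10 R).
apply: eq_log_integrable => t _.
by rewrite /osc_pow !mul0r expR0 cos0 mul1r mulr1 addr0 expr0 mulr1.
Qed.

(** Up to the term with a lower power of the logarithm, averaging inverts the
    action of a + 1 + b J on the pair (p, q), where J is the quarter turn. *)
Lemma cesaroR_osc_pow (a b p q : R) m (x : R) : -1 < a -> 0 < x ->
  osc_pow a b p q m x = (a + 1) * cesaroR (osc_pow a b p q m) x
    + b * cesaroR (osc_pow a b q (- p) m) x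
    + m%:R * cesaroR (osc_pow a b p q m.-1) x.
Proof.
move=> a1 x0; have xn0 : x != 0 by rewrite gt_eqF.
have E p' q' m' : \int[mu]_(t in `]0, x]) osc_pow a b p' q' m' t =
    \int[lebesgue_measure]_(t in `]0, x]) osc_pow a b p' q' m' t.
  have mosc := measurable_int (@lebesgue_measure R)
    (integrable_osc_pow b p' q' m' x a1).
  by rewrite /Rintegral (integral_completed (measurable_itv _) mosc).
apply: (mulfI xn0); rewrite integral_osc_pow// /cesaroR !E.
by field.
Qed.

Lemma cesaroRD (g h : R -> R) x : log_integrable g -> log_integrable h ->
  cesaroR (fun t => g t + h t) x = cesaroR g x + cesaroR h x.
Proof.
move=> gi hi; rewrite /cesaroR -mulrDr RintegralD//.
- exact: measurable_itv_lebesgue.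
- exact: log_integrable_itv.
- exact: log_integrable_itv.
Qed.

Lemma cesaroRZ (k : R) (g : R -> R) x : log_integrable g ->
  cesaroR (fun t => k * g t) x = k * cesaroR g x.
Proof.
move=> gi; rewrite /cesaroR RintegralZl//; first by rewrite mulrCA.
- exact: measurable_itv_lebesgue.
- exact: log_integrable_itv.
Qed.

Lemma completed_mu_itv (a b : R) : a <= b -> mu `]a, b] = (b - a)%:E.
Proof.
move=> ab; rewrite -[LHS]/(lebesgue_measure `]a, b]) lebesgue_measure_itv/= lte_fin.
by move: ab; rewrite le_eqVlt => /predU1P[->|->]; rewrite ?ltxx ?subrr.
Qed.

Lemma Rintegral_cst_itv (k a b : R) : a <= b ->
  \int[mu]_(t in `]a, b]) k = k * (b - a).
Proof.
move=> ab; rewrite Rintegral_cst; last exact: measurable_itv_lebesgue.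
by congr (_ * _); rewrite [X in fine X](_ : _ = (b - a)%:E)//; exact: completed_mu_itv.
Qed.

Lemma cesaroR_cst (k x : R) : 0 < x -> cesaroR (fun=> k) x = k.
Proof.
move=> x0; rewrite /cesaroR Rintegral_cst_itv ?ltW// subr0.
by field; rewrite gt_eqF.
Qed.

(** Averaging preserves limits: beyond a point A the integrand is within e/2 of
    the limit, and the contribution of ]0, A] is a constant divided by x. *)
Lemma cvg_cesaroR (g : R -> R) (l : R) : log_integrable g ->
  g x @[x --> +oo] --> l -> cesaroR g x @[x --> +oo] --> l.
Proof.
move=> gi gl.
pose h t := g t + - l.
have hi : log_integrable h by apply: log_integrableD => //; exact: log_integrable_cst.
have nhi := log_integrable_norm hi.
apply/cvgrPdist_le => /= e e0.
have e20 : 0 < e / 2 by rewrite divr_gt0.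
have [A0 [_ HA0]] := (@cvgrPdist_le _ _ _ _ _ g l).1 gl _ e20.
pose A := Num.max 1 A0.
have A1 : 1 <= A by rewrite /A le_max lexx.
have A_gt0 : 0 < A by exact: lt_le_trans A1.
have HA t : A < t -> `|h t| <= e / 2.
  by move=> At; rewrite /h distrC; apply: HA0;
    rewrite (le_lt_trans _ At)// /A le_max lexx orbT.
pose M := \int[mu]_(t in `]0, A]) `|h t|.
have M0 : 0 <= M by apply: Rintegral_ge0 => t _.
near=> x.
have Ax : A < x by near: x; apply: nbhs_pinfty_gt; exact: num_real.
have Mx : M / (e / 2) < x by near: x; apply: nbhs_pinfty_gt; exact: num_real.
have x0 : 0 < x by exact: lt_trans Ax.
rewrite distrC -{1}[l](cesaroR_cst l x0) -[- cesaroR _ _]mulN1r.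
rewrite -cesaroRZ; last exact: log_integrable_cst.
rewrite -cesaroRD//; last by apply: log_integrableZ; exact: log_integrable_cst.
rewrite /cesaroR normrM gtr0_norm ?invr_gt0//.
rewrite ler_pdivrMl//.
have mD := measurable_itv_lebesgue `]0, x].
have -> : \int[mu]_(t in `]0, x]) (g t + -1 * l) = \int[mu]_(t in `]0, x]) h t.
  by apply: eq_Rintegral => t _; rewrite /h mulN1r.
have ih := log_integrable_itv x hi; have inh := log_integrable_itv x nhi.
rewrite (le_trans (le_normr_Rintegral mD ih))//.
have splitE : `]0, x]%classic = `]0, A]%classic `|` `]A, x]%classic :> set R.
  by rewrite -itv_bndbnd_setU// bnd_simp ltW.
rewrite splitE Rintegral_setU//; first last.
- apply/disj_setPS => y [/=]; rewrite 2!in_itv/= => /andP[_ yA] /andP[].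
  by rewrite ltNge yA.
- by rewrite -splitE.
- exact: measurable_itv_lebesgue.
- exact: measurable_itv_lebesgue.
have -> : x * e = x * (e / 2) + x * (e / 2) by field.
rewrite lerD//.
  by rewrite -/M -ler_pdivrMr// ltW.
have mAx := measurable_itv_lebesgue `]A, x].
have sub : (`]A, x]%classic : set (lebesgueTypeR R)) `<=` `]0, x].
  by rewrite splitE; exact: subsetUr.
apply: (@le_trans _ _ (\int[mu]_(t in `]A, x]) (e / 2))).
  apply: le_Rintegral => //.
  - exact: integrableS mD mAx sub inh.
  - exact: integrableS mD mAx sub (log_integrable_itv x (log_integrable_cst _)).
  - by move=> t /=; rewrite in_itv/= => /andP[At _]; exact: HA.
by rewrite (Rintegral_cst_itv _ (ltW Ax)) [leRHS]mulrC ler_pM2l// gerBl ltW.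
Unshelve. all: by end_near. Qed.

End regularity.

(** * From real and imaginary parts to complex functions *)

Section complex_layer.
Context {R : realType}.
Local Notation mu := (completed_mu R).
Local Notation C := R[i].
Implicit Types (f g : R -> C) (c : C) (x : R).

Lemma normc_ge_ReIm (z : C) :
  `|complex.Re z| <= Normc.normc z /\ `|complex.Im z| <= Normc.normc z.
Proof.
case: z => a b /=; split.
  by rewrite -sqrtr_sqr ler_wsqrtr// lerDl sqr_ge0.
by rewrite -sqrtr_sqr ler_wsqrtr// lerDr sqr_ge0.
Qed.

Lemma normc_le_ReIm (z : C) :
  Normc.normc z <= `|complex.Re z| + `|complex.Im z|.
Proof.
case: z => a b /=; rewrite -[leRHS]ger0_norm ?addr_ge0// -[leRHS]sqrtr_sqr.
rewrite ler_wsqrtr// -(real_normK (num_real a)) -(real_normK (num_real b)).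
by rewrite sqrrD -addrA lerD2l lerDr mulrn_wge0// mulr_ge0.
Qed.

Lemma ReD (z w : C) : complex.Re (z + w) = complex.Re z + complex.Re w.
Proof. by case: z; case: w. Qed.
Lemma ImD (z w : C) : complex.Im (z + w) = complex.Im z + complex.Im w.
Proof. by case: z; case: w. Qed.
Lemma ReM (z w : C) :
  complex.Re (z * w) = complex.Re z * complex.Re w - complex.Im z * complex.Im w.
Proof. by case: z; case: w. Qed.
Lemma ImM (z w : C) :
  complex.Im (z * w) = complex.Re z * complex.Im w + complex.Im z * complex.Re w.
Proof. by case: z; case: w. Qed.
Lemma eq_ReIm (z w : C) :
  complex.Re z = complex.Re w -> complex.Im z = complex.Im w -> z = w.
Proof. by case: z => ? ?; case: w => ? ? /= -> ->. Qed.

Lemma measurable_normc d (T : measurableType d) (D : set T) (u v : T -> R) :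
  measurable_fun D u -> measurable_fun D v ->
  measurable_fun D (fun t => Normc.normc (u t +i* v t)).
Proof.
move=> m_u m_v; apply: (measurableT_comp (f := @Num.sqrt R)).
  by apply: continuous_measurable_fun; exact: sqrt_continuous.
by apply: measurable_funD; exact: measurable_funX.
Qed.

(** Reduces the complex space to the real theory. Integrability of the modulus
    is compared with that of the two parts through the norm inequalities above;
    intervals ]0, x] with x < 1 are recovered by restriction. *)
Lemma spaceFP f : spaceF f <->
  log_integrable (fun t => complex.Re (f t)) /\
  log_integrable (fun t => complex.Im (f t)).
Proof.
have partE (h : C -> R) m (t : R) :
    h = complex.Re (R := R) \/ h = complex.Im (R := R) ->
    h (f t) * ln t ^+ m = h (f t * (ln t ^+ m)%:C).
  by case=> ->; rewrite ?ReM ?ImM /= mulr0 ?subr0 ?addr0 // add0r.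
have FE m (t : R) : f t * (ln t ^+ m)%:C =
    (complex.Re (f t) * ln t ^+ m) +i* (complex.Im (f t) * ln t ^+ m).
  by rewrite !partE; [case: (_ * _)|right|left].
have nFE m (t : R) := congr1 (@Normc.normc R) (FE m t).
have mD x : measurable (`]0, x]%classic : set (lebesgueTypeR R)).
  exact: measurable_itv_lebesgue.
have mln x m : measurable_fun (`]0, x]%classic : set (lebesgueTypeR R))
    (fun t : lebesgueTypeR R => ln (t : R) ^+ m).
  apply: measurable_funX; apply: (@measurable_fun_borel_lebesgue R _ R _ (@ln R)).
    exact: measurable_itv.
  exact: measurable_funTS.
split.
  move=> [mRe mIm fint].
  have sub x : (`]0, x]%classic : set (lebesgueTypeR R)) `<=` `]0, +oo[.
    by move=> t /=; rewrite !in_itv/= => /andP[->].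
  have key (h : C -> R) : h = complex.Re (R := R) \/ h = complex.Im (R := R) ->
      lebesgue_measurable_fun `]0, +oo[ (fun t => h (f t)) ->
      log_integrable (fun t => h (f t)).
    move=> hE mh x m.
    have mh' := measurable_funS (measurable_itv_lebesgue _) (sub (Num.max 1 x)) mh.
    have mRe' := measurable_funS (measurable_itv_lebesgue _) (sub (Num.max 1 x)) mRe.
    have mIm' := measurable_funS (measurable_itv_lebesgue _) (sub (Num.max 1 x)) mIm.
    have subx : (`]0, x]%classic : set (lebesgueTypeR R)) `<=` `]0, Num.max 1 x].
      move=> t /=; rewrite !in_itv/= => /andP[-> tx].
      by rewrite le_max tx orbT.
    apply: (integrableS (mD _) (mD _) subx); apply/integrableP; split.
      by apply/measurable_EFinP; apply: measurable_funM => //; exact: mln.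
    have x1 : 1 <= Num.max 1 x by rewrite le_max lexx.
    apply: (le_lt_trans _ (fint _ m x1)).
    apply: ge0_le_integral; first exact: mD.
    - by [].
    - apply/measurable_EFinP; apply: measurableT_comp; first exact: normr_measurable.
      by apply: measurable_funM => //; exact: mln.
    - apply/measurable_EFinP; rewrite [X in measurable_fun _ X](funext (nFE m)).
      by apply: measurable_normc; apply: measurable_funM => //; exact: mln.
    - move=> t _; rewrite lee_fin partE//.
      by have [] := normc_ge_ReIm (f t * (ln t ^+ m)%:C); case: hE => ->.
  by split; apply: key => //; [left|right].
move=> [iRe iIm].
have meas (u : R -> R) : log_integrable u -> lebesgue_measurable_fun `]0, +oo[ u.
  move=> iu; rewrite /lebesgue_measurable_fun itv_bndy_bigcup_BRight.
  apply/(@measurable_fun_bigcup _ _ (lebesgueTypeR R)) => n.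
    exact: measurable_itv_lebesgue.
  apply/measurable_EFinP.
  exact: (measurable_int mu (log_integrable_itv (0 + n%:R) iu)).
split; [exact: meas|exact: meas|move=> x m x1].
have iF := integrableD (mD x) (integrable_norm (iRe x m)) (integrable_norm (iIm x m)).
apply: (le_lt_trans _ (integrable_lty (mD x) iF)).
have mprod (u : R -> R) : log_integrable u ->
    measurable_fun (`]0, x]%classic : set (lebesgueTypeR R))
      (fun t : lebesgueTypeR R => u t * ln (t : R) ^+ m).
  by move=> iu; apply/measurable_EFinP; exact: (measurable_int mu (iu x m)).
apply: ge0_le_integral; first exact: mD.
- move=> t _; rewrite lee_fin; case: (f t * _) => a b; exact: sqrtr_ge0.
- apply/measurable_EFinP; rewrite [X in measurable_fun _ X](funext (nFE m)).
  by apply: measurable_normc; exact: mprod.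
- exact: measurable_int iF.
- move=> t _; rewrite /= -EFinD lee_fin.
  rewrite (partE (complex.Re (R := R))); last by left.
  rewrite (partE (complex.Im (R := R))); last by right.
  exact: normc_le_ReIm.
Qed.

Lemma classical_limP f (L : C) : classical_lim f L <->
  complex.Re (f x) @[x --> +oo] --> complex.Re L /\
  complex.Im (f x) @[x --> +oo] --> complex.Im L.
Proof.
split=> [fL|[fRe fIm]].
  have H (e : R) : 0 < e -> \forall x \near +oo, Normc.normc (L - f x) <= e.
    move=> e0; have := (@cvgrPdist_le R[i] R[i]^o _ _ _ f L).1 fL e%:C.
    rewrite ltcR => /(_ _ e0); apply: filterS => x.
    by rewrite lecE/= => /andP[].
  split; apply/cvgrPdist_le => e e0; apply: filterS (H e e0) => x; apply: le_trans.
    have [+ _] := normc_ge_ReIm (L - f x); apply: le_trans.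
    by case: L {fL H} => a b; case: (f x).
  have [_ +] := normc_ge_ReIm (L - f x); apply: le_trans.
  by case: L {fL H} => a b; case: (f x).
apply/(@cvgrPdist_le R[i] R[i]^o) => e.
case: e => e e'; rewrite ltcE/= => /andP[/eqP -> e0].
have e20 : 0 < e / 2 by rewrite divr_gt0.
near=> x.
rewrite lecE/= eqxx/= (le_trans (normc_le_ReIm _))// [leRHS]splitr lerD//.
  rewrite (_ : complex.Re _ = complex.Re L - complex.Re (f x)); last first.
    by rewrite ReD; case: (f x).
  near: x; exact: ((@cvgrPdist_le R R^o _ _ _ _ _).1 fRe _ e20).
rewrite (_ : complex.Im _ = complex.Im L - complex.Im (f x)); last first.
  by rewrite ImD; case: (f x).
near: x; exact: ((@cvgrPdist_le R R^o _ _ _ _ _).1 fIm _ e20).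
Unshelve. all: by end_near. Qed.

Lemma Re_cesaroP f x : complex.Re (cesaroP f x) = cesaroR (fun t => complex.Re (f t)) x.
Proof. by rewrite /cesaroP /= mul0r subr0. Qed.

Lemma Im_cesaroP f x : complex.Im (cesaroP f x) = cesaroR (fun t => complex.Im (f t)) x.
Proof. by rewrite /cesaroP /= mul0r addr0. Qed.

Lemma spaceF_cesaroP f : spaceF f -> spaceF (cesaroP f).
Proof.
move=> /spaceFP[iRe iIm]; apply/spaceFP; split.
  by apply: eq_log_integrable (log_integrable_cesaroR iRe) => t _; rewrite Re_cesaroP.
by apply: eq_log_integrable (log_integrable_cesaroR iIm) => t _; rewrite Im_cesaroP.
Qed.

Lemma spaceF_lin c f g : spaceF f -> spaceF g -> spaceF (fun x => c * f x + g x).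
Proof.
move=> /spaceFP[fRe fIm] /spaceFP[gRe gIm]; apply/spaceFP; split.
  have := log_integrableD (log_integrableD (log_integrableZ (complex.Re c) fRe)
    (log_integrableZ (- complex.Im c) fIm)) gRe.
  by apply: eq_log_integrable => t _; rewrite ReD ReM mulNr.
have := log_integrableD (log_integrableD (log_integrableZ (complex.Re c) fIm)
  (log_integrableZ (complex.Im c) fRe)) gIm.
by apply: eq_log_integrable => t _; rewrite ImD ImM.
Qed.

Lemma cesaroP_lin c f g : spaceF f -> spaceF g ->
  cesaroP (fun x => c * f x + g x) = fun x => c * cesaroP f x + cesaroP g x.
Proof.
move=> /spaceFP[fRe fIm] /spaceFP[gRe gIm]; apply/funext => x; apply: eq_ReIm.
  rewrite Re_cesaroP ReD ReM !Re_cesaroP !Im_cesaroP -mulNr.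
  rewrite -!cesaroRZ// -!cesaroRD//;
    do ?[exact: log_integrableZ|apply: log_integrableD => //].
  by congr cesaroR; apply/funext => t; rewrite ReD ReM mulNr.
rewrite Im_cesaroP ImD ImM !Re_cesaroP !Im_cesaroP.
rewrite -!cesaroRZ// -!cesaroRD//;
    do ?[exact: log_integrableZ|apply: log_integrableD => //].
by congr cesaroR; apply/funext => t; rewrite ImD ImM.
Qed.

Lemma classical_lim_lin c f g (L M : C) : classical_lim f L -> classical_lim g M ->
  classical_lim (fun x => c * f x + g x) (c * L + M).
Proof.
move=> /classical_limP[fRe fIm] /classical_limP[gRe gIm]; apply/classical_limP.
split.
  rewrite ReD ReM.
  apply: cvg_trans (cvgD (cvgB (cvgM (cvg_cst (complex.Re c)) fRe)
    (cvgM (cvg_cst (complex.Im c)) fIm)) gRe); apply: near_eq_cvg.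
  by apply: nearW => x; rewrite /= ReD ReM.
rewrite ImD ImM.
apply: cvg_trans (cvgD (cvgD (cvgM (cvg_cst (complex.Re c)) fIm)
  (cvgM (cvg_cst (complex.Im c)) fRe)) gIm); apply: near_eq_cvg.
  by apply: nearW => x; rewrite /= ImD ImM.
Qed.

Lemma classical_lim_cesaroP f (L : C) : spaceF f -> classical_lim f L ->
  classical_lim (cesaroP f) L.
Proof.
move=> /spaceFP[fRe fIm] /classical_limP[LRe LIm]; apply/classical_limP; split.
  apply: cvg_trans (cvg_cesaroR fRe LRe); apply: near_eq_cvg.
  by apply: nearW => x; rewrite Re_cesaroP.
apply: cvg_trans (cvg_cesaroR fIm LIm); apply: near_eq_cvg.
  by apply: nearW => x; rewrite Im_cesaroP.
Qed.

End complex_layer.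

(** * The action of polynomials in the Cesaro operator *)

Section polynomials_in_cesaro.
Context {R : realType}.
Local Notation C := R[i].
Local Notation P := (@cesaroP R).
Implicit Types (f g : R -> C) (c : C) (x : R) (p q : {poly C}).

Lemma spaceF0 : spaceF (fun=> 0 : C).
Proof. by apply/spaceFP; split; exact: log_integrable_cst. Qed.

Lemma spaceF_sum (I : Type) (s : seq I) (Q : pred I) (a : I -> C)
    (u : I -> R -> C) : (forall j, Q j -> spaceF (u j)) ->
  spaceF (fun x => \sum_(j <- s | Q j) a j * u j x).
Proof.
move=> uF; elim: s => [|j s IH].
  by have := spaceF0; congr spaceF; apply/funext => x; rewrite big_nil.
have [Qj|Qj] := boolP (Q j).
  have := spaceF_lin (a j) (uF j Qj) IH.
  by congr spaceF; apply/funext => x; rewrite big_cons Qj.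
by move: IH; congr spaceF; apply/funext => x; rewrite big_cons (negbTE Qj).
Qed.

Lemma spaceF_iter k f : spaceF f -> spaceF (iter k P f).
Proof. by move=> fF; elim: k => //= k; exact: spaceF_cesaroP. Qed.

Lemma iter_cesaroP_lin k c f g : spaceF f -> spaceF g ->
  iter k P (fun x => c * f x + g x) = fun x => c * iter k P f x + iter k P g x.
Proof.
move=> fF gF; elim: k => //= k ->.
by rewrite cesaroP_lin//; exact: spaceF_iter.
Qed.

Lemma cesaroP0 : P (fun=> 0) = fun=> 0.
Proof.
apply/funext => x; apply: eq_ReIm; rewrite ?Re_cesaroP ?Im_cesaroP /cesaroR /=.
  by rewrite Rintegral_cst ?mul0r ?mulr0//; exact: measurable_itv_lebesgue.
by rewrite Rintegral_cst ?mul0r ?mulr0//; exact: measurable_itv_lebesgue.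
Qed.

Lemma poly_cesaroE n q f x : (size q <= n)%N ->
  poly_cesaro q f x = \sum_(k < n) q`_k * iter k P f x.
Proof.
move=> qn; rewrite /poly_cesaro (big_ord_widen n (fun k => q`_k * iter k P f x))//.
rewrite big_mkcond/=; apply: eq_bigr => k _; case: ltnP => // qk.
by rewrite nth_default// mul0r.
Qed.

Lemma poly_cesaro_lin q c f g : spaceF f -> spaceF g ->
  poly_cesaro q (fun x => c * f x + g x) =
  fun x => c * poly_cesaro q f x + poly_cesaro q g x.
Proof.
move=> fF gF; apply/funext => x; rewrite /poly_cesaro mulr_sumr -big_split/=.
by apply: eq_bigr => k _; rewrite iter_cesaroP_lin// mulrDr mulrCA.
Qed.

Lemma iter_cesaroP0 k : iter k P (fun=> 0) = fun=> 0.
Proof. by elim: k => //= k ->; exact: cesaroP0. Qed.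

Lemma poly_cesaro_fun0 q : poly_cesaro q (fun=> 0) = fun=> 0.
Proof.
apply/funext => x; rewrite /poly_cesaro big1// => k _.
by rewrite iter_cesaroP0 mulr0.
Qed.

Lemma poly_cesaroZ q c f : spaceF f ->
  poly_cesaro q (fun x => c * f x) = fun x => c * poly_cesaro q f x.
Proof.
move=> fF; apply/funext => x.
have := congr1 (@^~ x) (poly_cesaro_lin q c fF spaceF0) => /=.
rewrite poly_cesaro_fun0 addr0 => <-; congr poly_cesaro.
by apply/funext => y; rewrite addr0.
Qed.

Lemma poly_cesaro_linl c p q f x :
  poly_cesaro (c *: p + q) f x = c * poly_cesaro p f x + poly_cesaro q f x.
Proof.
pose n := maxn (size (c *: p + q)) (maxn (size p) (size q)).
rewrite !(@poly_cesaroE n) ?leq_max ?leqnn ?orbT//.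
rewrite mulr_sumr -big_split/=; apply: eq_bigr => k _.
by rewrite coefD coefZ mulrDl mulrA.
Qed.

Lemma poly_cesaro0 f x : poly_cesaro 0 f x = 0.
Proof. by rewrite /poly_cesaro size_poly0 big_ord0. Qed.

Lemma poly_cesaroC c f x : poly_cesaro c%:P f x = c * f x.
Proof. by rewrite (@poly_cesaroE 1) ?size_polyC_leq1// big_ord1 coefC. Qed.

Lemma poly_cesaroMX q f x : poly_cesaro (q * 'X) f x = poly_cesaro q (P f) x.
Proof.
rewrite (@poly_cesaroE (size q).+1); last first.
  by rewrite (leq_trans (size_polyMleq _ _))// size_polyX addn2.
rewrite big_ord_recl coefMX mul0r add0r /poly_cesaro; apply: eq_bigr => k _.
by rewrite coefMX/= -iterSr.
Qed.

Lemma poly_cesaroMXaddC q c f :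
  poly_cesaro (q * 'X + c%:P) f = fun x => c * f x + poly_cesaro q (P f) x.
Proof.
apply/funext => x; rewrite -[q * 'X]scale1r poly_cesaro_linl mul1r.
by rewrite poly_cesaroMX poly_cesaroC addrC.
Qed.

Lemma poly_cesaroXn n f : poly_cesaro 'X^n f = iter n P f.
Proof.
elim: n f => [|n IH] f.
  by apply/funext => x; rewrite expr0 -[1]/(1%:P) poly_cesaroC mul1r.
by rewrite exprSr iterSr -IH; apply/funext => x; rewrite poly_cesaroMX.
Qed.

Lemma classical_lim_iter k f (L : C) : spaceF f -> classical_lim f L ->
  classical_lim (iter k P f) L.
Proof.
move=> fF fL; elim: k => //= k.
by apply: classical_lim_cesaroP; exact: spaceF_iter.
Qed.

Lemma spaceF_poly_cesaro q f : spaceF f -> spaceF (poly_cesaro q f).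
Proof.
by move=> fF; apply: spaceF_sum => k _; exact: spaceF_iter.
Qed.

Lemma cesaroP_poly_cesaro q f : spaceF f -> P (poly_cesaro q f) = poly_cesaro q (P f).
Proof.
move=> fF; elim/poly_ind: q f fF => [|q c IH] f fF.
  have -> : poly_cesaro 0 f = fun=> 0 by apply/funext => x; rewrite poly_cesaro0.
  by rewrite cesaroP0; apply/funext => x; rewrite poly_cesaro0.
rewrite !poly_cesaroMXaddC cesaroP_lin//; last exact/spaceF_poly_cesaro/spaceF_cesaroP.
by rewrite IH//; exact: spaceF_cesaroP.
Qed.

(** Composition of the operators is multiplication of the polynomials, but only
    on the space where every iterate is integrable: elsewhere the operator
    need not be linear. *)
Lemma poly_cesaroM p q f : spaceF f ->
  poly_cesaro (p * q) f = poly_cesaro p (poly_cesaro q f).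
Proof.
move=> fF; elim/poly_ind: p q f fF => [|p c IH] q f fF.
  by apply/funext => x; rewrite mul0r !poly_cesaro0.
have -> : (p * 'X + c%:P) * q = c *: q + p * (q * 'X).
  by rewrite mulrDl mul_polyC addrC -mulrA (mulrC 'X).
apply/funext => x; rewrite poly_cesaro_linl IH// poly_cesaroMXaddC.
congr (_ + poly_cesaro p _ x); rewrite cesaroP_poly_cesaro//.
by apply/funext => y; rewrite poly_cesaroMX.
Qed.

(** The value at 1 is the factor by which a polynomial in a limit-preserving
    operator scales limits; this is where regularity of the polynomial enters. *)
Lemma classical_lim_poly_cesaro q f (L : C) : spaceF f -> classical_lim f L ->
  classical_lim (poly_cesaro q f) (q.[1] * L).
Proof.
move=> fF fL; elim/poly_ind: q f fF fL => [|q c IH] f fF fL.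
  have -> : poly_cesaro 0 f = fun=> 0 by apply/funext => x; rewrite poly_cesaro0.
  by rewrite horner0 mul0r; exact: (@cvg_cst R[i]^o).
have PL := IH _ (spaceF_cesaroP fF) (classical_lim_cesaroP fF fL).
have := @classical_lim_lin _ c _ _ _ _ fL PL.
by rewrite poly_cesaroMXaddC hornerMXaddC mulr1 mulrDl [c * L + _]addrC.
Qed.

End polynomials_in_cesaro.

(** * Annihilating complex powers times logarithms *)

Section log_powers.
Context {R : realType}.
Local Notation C := R[i].
Local Notation P := (@cesaroP R).
Implicit Types (f g : R -> C) (c rho : C) (x : R) (p q : {poly C}).

(** Vanishing on ]-oo, 0], as every average does, turns the identities below
    into equalities of functions on the whole line. *)
Definition log_pow rho m x : C :=
  if 0 < x then cpowR x rho * (ln x ^+ m)%:C else 0.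

Lemma Re_log_pow rho m x : 0 < x -> complex.Re (log_pow rho m x) =
  osc_pow (complex.Re rho) (complex.Im rho) 1 0 m x.
Proof. by rewrite /log_pow => ->; rewrite /cpowR /osc_pow/=; ring. Qed.

Lemma Im_log_pow rho m x : 0 < x -> complex.Im (log_pow rho m x) =
  osc_pow (complex.Re rho) (complex.Im rho) 0 1 m x.
Proof. by rewrite /log_pow => ->; rewrite /cpowR /osc_pow/=; ring. Qed.

Lemma spaceF_log_pow rho m : -1 < complex.Re rho -> spaceF (log_pow rho m).
Proof.
move=> rho1; apply/spaceFP; split.
  apply: eq_log_integrable (log_integrable_osc_pow (complex.Im rho) 1 0 m rho1).
  by move=> t t0; rewrite Re_log_pow.
apply: eq_log_integrable (log_integrable_osc_pow (complex.Im rho) 0 1 m rho1).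
by move=> t t0; rewrite Im_log_pow.
Qed.

Lemma eq_cesaroR (g h : R -> R) x : (forall t, 0 < t -> g t = h t) ->
  cesaroR g x = cesaroR h x.
Proof.
move=> gh; congr (_ * _); apply: eq_Rintegral => t.
by rewrite inE/= in_itv/= => /andP[/gh].
Qed.

Lemma osc_powZ (k a b p q : R) m :
  osc_pow a b (k * p) (k * q) m = fun t => k * osc_pow a b p q m t.
Proof. by apply/funext => t; rewrite /osc_pow; ring. Qed.

(** x^rho (ln x)^m is an eigenfunction of the averaging operator for the
    eigenvalue 1 / (1 + rho), up to a lower power of the logarithm. *)
Lemma cesaroP_log_pow rho m : -1 < complex.Re rho ->
  log_pow rho m = fun x => (1 + rho) * P (log_pow rho m) x
    + m%:R * P (log_pow rho m.-1) x.
Proof.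
move=> rho1; apply/funext => x; have [x0|x0] := ltP 0 x; last first.
  rewrite /log_pow ltNge x0/= /cesaroP /cintegral set_itv_ge ?bnd_simp -?leNgt//.
  by rewrite !Rintegral_set0 !mulr0 addr0.
pose a := complex.Re rho; pose b := complex.Im rho.
have ReP k : complex.Re (P (log_pow rho k) x) = cesaroR (osc_pow a b 1 0 k) x.
  by rewrite Re_cesaroP; apply: eq_cesaroR => t t0; rewrite Re_log_pow.
have ImP k : complex.Im (P (log_pow rho k) x) = cesaroR (osc_pow a b 0 1 k) x.
  by rewrite Im_cesaroP; apply: eq_cesaroR => t t0; rewrite Im_log_pow.
have mE : (m%:R : C) = (m%:R : R)%:C by rewrite rmorph_nat.
apply: eq_ReIm.
  rewrite Re_log_pow// cesaroR_osc_pow// ReD (ReM (1 + rho)) (ReM m%:R).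
  rewrite !ReP !ImP mE ReD ImD /= -/a -/b.
  have -> : osc_pow a b 0 (- 1) m = fun t => -1 * osc_pow a b 0 1 m t.
    by rewrite -osc_powZ mulr0 mulr1.
  by rewrite cesaroRZ; [ring|exact: log_integrable_osc_pow].
rewrite Im_log_pow// cesaroR_osc_pow// oppr0 ImD (ImM (1 + rho)) (ImM m%:R).
rewrite !ReP !ImP mE ReD ImD /= -/a -/b.
by ring.
Qed.

(** The polynomial of degree at most 1 that vanishes at the eigenvalue
    1 / (1 + rho), scaled to take the value 1 at 1. That scaling is possible
    precisely because rho is nonzero. *)
Definition annihilator rho : {poly C} := rho^-1 *: ((1 + rho) *: 'X - 1).

Lemma annihilator1 rho : rho != 0 -> (annihilator rho).[1] = 1.
Proof.
by move=> rho0; rewrite /annihilator !hornerE; field.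
Qed.

Lemma annihilator_log_pow rho m : -1 < complex.Re rho -> rho != 0 ->
  poly_cesaro (annihilator rho) (log_pow rho m) =
  fun x => - (m%:R / rho) * P (log_pow rho m.-1) x.
Proof.
move=> rho1 rho0; apply/funext => x.
have -> : annihilator rho = (rho^-1 * (1 + rho))%:P * 'X + (- rho^-1)%:P.
  by rewrite /annihilator scalerBr scalerA mul_polyC alg_polyC polyCN.
rewrite poly_cesaroMXaddC poly_cesaroC [X in - _ * X x]cesaroP_log_pow//.
by field.
Qed.

(** Each factor lowers the degree of the logarithm by one. *)
Lemma annihilatorX_log_pow rho m : -1 < complex.Re rho -> rho != 0 ->
  poly_cesaro (annihilator rho ^+ m.+1) (log_pow rho m) = fun=> 0.
Proof.
move=> rho1 rho0; have uF k := spaceF_log_pow k rho1.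
elim: m => [|m IH].
  rewrite expr1 annihilator_log_pow//; apply/funext => x.
  by rewrite mul0r oppr0 mul0r.
rewrite exprSr poly_cesaroM// annihilator_log_pow//.
rewrite poly_cesaroZ; last exact: spaceF_cesaroP.
by rewrite -cesaroP_poly_cesaro// IH cesaroP0; apply/funext => x; rewrite mulr0.
Qed.

Lemma classical_lim_log_pow0 rho m : complex.Re rho < 0 ->
  classical_lim (log_pow rho m) 0.
Proof.
move=> rho0; apply/classical_limP; split.
  apply: cvg_trans (cvg_osc_pow_pinfty (complex.Im rho) 1 0 m rho0).
  apply: near_eq_cvg; near=> x.
  have x0 : 0 < x by near: x; apply: nbhs_pinfty_gt; exact: num_real.
  by rewrite Re_log_pow.
apply: cvg_trans (cvg_osc_pow_pinfty (complex.Im rho) 0 1 m rho0).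
apply: near_eq_cvg; near=> x.
have x0 : 0 < x by near: x; apply: nbhs_pinfty_gt; exact: num_real.
by rewrite Im_log_pow.
Unshelve. all: by end_near. Qed.

Lemma eq_classical_lim f g (L : C) : (forall x, 0 < x -> f x = g x) ->
  classical_lim f L -> classical_lim g L.
Proof.
move=> fg; apply: cvg_trans; apply: near_eq_cvg; near=> x; apply: fg.
by near: x; apply: nbhs_pinfty_gt; exact: num_real.
Unshelve. all: by end_near. Qed.

End log_powers.

(** * Finite linear combinations *)

Section finite_sums.
Context {R : realType} {I : Type}.
Local Notation C := R[i].
Implicit Types (s : seq I) (Q : pred I) (c : I -> C) (u : I -> R -> C).

Lemma classical_lim_sum0 s Q c u : (forall j, Q j -> classical_lim (u j) 0) ->
  classical_lim (fun x => \sum_(j <- s | Q j) c j * u j x) 0.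
Proof.
move=> u0; elim: s => [|j s IH].
  apply: (@eq_classical_lim _ (fun=> 0)); last exact: (@cvg_cst R[i]^o).
  by move=> x _; rewrite big_nil.
have [Qj|Qj] := boolP (Q j).
  have := @classical_lim_lin _ (c j) _ _ _ _ (u0 j Qj) IH; rewrite mulr0 addr0.
  by apply: eq_classical_lim => x _; rewrite big_cons Qj.
by move: IH; apply: eq_classical_lim => x _; rewrite big_cons (negbTE Qj).
Qed.

Lemma poly_cesaro_sum0 (q : {poly C}) s Q c u : (forall j, Q j -> spaceF (u j)) ->
  (forall j, Q j -> poly_cesaro q (u j) = fun=> 0) ->
  poly_cesaro q (fun x => \sum_(j <- s | Q j) c j * u j x) = fun=> 0.
Proof.
move=> uF qu; elim: s => [|j s IH].
  rewrite -[RHS](poly_cesaro_fun0 q); congr poly_cesaro.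
  by apply/funext => x; rewrite big_nil.
have [Qj|Qj] := boolP (Q j); last first.
  rewrite -[RHS]IH; congr poly_cesaro.
  by apply/funext => x; rewrite big_cons (negbTE Qj).
have := poly_cesaro_lin q (c j) (uF j Qj) (spaceF_sum s c uF).
rewrite qu// IH => qS; rewrite -[RHS](_ : (fun=> c j * 0 + 0) = _); last first.
  by apply/funext => x; rewrite mulr0 addr0.
by rewrite -qS; congr poly_cesaro; apply/funext => x; rewrite big_cons Qj.
Qed.

End finite_sums.

Theorem theorem2 (R : realType) (f : R -> R[i]) (N : nat)
  (c rho : 'I_N -> R[i]) (m : 'I_N -> nat)
  (Rem : R -> R[i]) (r : nat) (L : R[i]) :
  spaceF f ->
  (forall j, rho j != 0) ->
  (forall x : R, 0 < x ->
    f x = (\sum_(j < N) c j * cpowR x (rho j) * (ln x ^+ m j)%:C) + Rem x) ->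
  (* P^r[Rem] is meaningful: P acts on the space F, P^0 is the identity *)
  ((0 < r)%N -> spaceF Rem) ->
  classical_lim (iter r (@cesaroP R) Rem) L ->
  Clim f L.
Proof.
move=> fF rho0 fE RemF RemL; split=> //.
pose good j := -1 < complex.Re (rho j).
pose u j := log_pow (rho j) (m j).
(* The part of the expansion that is integrable at 0. *)
pose S x := \sum_(j < N | good j) c j * u j x.
have uF j : good j -> spaceF (u j) by exact: spaceF_log_pow.
have SF : spaceF S by exact: spaceF_sum.
pose T x := -1 * S x + f x.
have TF : spaceF T by exact: spaceF_lin.
pose E x := -1 * Rem x + T x.
(* E is the rest of the expansion; all its exponents have real part <= -1. *)
have E0 : classical_lim E 0.
  apply: (@eq_classical_lim _ (fun x => \sum_(j < N | ~~ good j) c j * u j x)).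
    move=> x x0; rewrite /E /T fE// /S.
    have uE j : c j * cpowR x (rho j) * (ln x ^+ m j)%:C = c j * u j x.
      by rewrite /u /log_pow x0 mulrA.
    by rewrite (eq_bigr _ (fun j _ => uE j)) [X in X + Rem x](bigID good)/=; ring.
  apply: classical_lim_sum0 => j; rewrite -leNgt => rj.
  by apply: classical_lim_log_pow0; rewrite (le_lt_trans rj)// ltrN10.
have TE : T = fun x => 1 * E x + Rem x.
  by apply/funext => x; rewrite /E; ring.
have TL : classical_lim (iter r (@cesaroP R) T) L.
  have EF : (0 < r)%N -> spaceF E by move=> /RemF /spaceF_lin; exact.
  rewrite TE -[L]add0r -[X in X + L](mulr0 1).
  case: (posnP r) RemL => [-> RemL|r0 RemL].
    exact: (@classical_lim_lin _ 1 _ _ _ _ E0 RemL).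
  rewrite (iter_cesaroP_lin r 1 (EF r0) (RemF r0)).
  exact: (@classical_lim_lin _ 1 _ _ _ _ (classical_lim_iter r (EF r0) E0) RemL).
pose g := \prod_(j < N | good j) annihilator (rho j) ^+ (m j).+1.
have g1 : g.[1] = 1.
  rewrite horner_prod big1// => j _.
  by rewrite horner_exp annihilator1// expr1n.
exists (g * 'X^r); split.
  by rewrite /regular_poly hornerM hornerXn expr1n g1 mulr1.
have qS : poly_cesaro (g * 'X^r) S = fun=> 0.
  apply: poly_cesaro_sum0 => // j goodj.
  rewrite /g (bigD1 j)//= mulrC mulrCA mulrC.
  rewrite poly_cesaroM ?annihilatorX_log_pow ?poly_cesaro_fun0//.
  exact: uF.
have -> : poly_cesaro (g * 'X^r) f = poly_cesaro g (iter r (@cesaroP R) T).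
  have fST : f = fun x => 1 * S x + T x by apply/funext => x; rewrite /T; ring.
  rewrite [in LHS]fST (poly_cesaro_lin _ 1 SF TF) qS poly_cesaroM// poly_cesaroXn.
  by apply/funext => x; rewrite mulr0 add0r.
have := @classical_lim_poly_cesaro _ g _ _ (spaceF_iter r TF) TL.
by rewrite g1 mul1r.
Qed.
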